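(* The distribution of $G_1+G_2$ with respect to the vacuum state (equivalently, the monotone convolution $\nu\rhd\nu$ of the standard semicircle law $\nu$ with itself) is absolutely continuous with density $$\rho(x)=\begin{cases}\frac{1}{4\pi}\Big(\sqrt{\sqrt{100-16x^2}-x^2+10}-\sqrt{4-x^2}\Big)&\text{if }|x|\le 2,\\[2pt] \frac{1}{4\pi}\sqrt{-2x^2-2|x|\sqrt{x^2-4}+20}&\text{if }2\le|x|\le\frac52,\\[2pt] 0&\text{if }|x|\ge\frac52.\end{cases}$$
   Context: The setting: weakly monotone Fock space $\mathfrak F_{WM}(\mathcal H)$ over a separable Hilbert space with orthonormal basis $\{e_i\}_{i\ge1}$, vacuum $\Omega$, spanned by $\Omega$ and tensors $e_{i_k}\otimes\cdots\otimes e_{i_1}$ with $i_k\ge\cdots\ge i_1$; weakly monotone annihilation/creation operators defined by $A_i\Omega=0$, $A_i(e_{i_k}\otimes\cdots\otimes e_{i_1})=\delta_{i,i_k}e_{i_{k-1}}\otimes\cdots\otimes e_{i_1}$, $A_i^\dagger\Omega=e_i$, $A_i^\dagger(e_{i_k}\otimes\cdots\otimes e_{i_1})=e_i\otimes e_{i_k}\otimes\cdots\otimes e_{i_1}$ if $i\ge i_k$ and $0$ otherwise; position operators $G_i=A_i+A_i^\dagger$; vacuum state $\omega_\Omega(X)=\langle\Omega,X\Omega\rangle$. The distribution of a bounded self-adjoint $X$ is the probability measure with moments $\omega_\Omega(X^n)$. The standard semicircle (Wigner) law is $\nu(dx)=\frac1{2\pi}\sqrt{4-x^2}\mathbf 1_{[-2,2]}dx$.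 For probability measures $\mu,\nu$ on $\mathbb R$ with Cauchy transforms $\mathcal G_\mu(z)=\int\frac{\mu(dx)}{z-x}$ and reciprocal Cauchy transforms $H_\mu=1/\mathcal G_\mu$, the monotone convolution $\mu\rhd\nu$ is the unique probability measure $\rho$ with $H_\rho=H_\mu\circ H_\nu$ on $\mathbb C^+$. *)

(* Defs.v *)
From Stdlib Require Import Reals List Arith.
Import ListNotations.
Open Scope R_scope.

(** * Weakly monotone Fock space (algebraic model)
    A basis tensor e_{i_k} (x) ... (x) e_{i_1} (i_k >= ... >= i_1 >= 1) is the
    list [i_k; ...; i_1] of indices; the vacuum Omega is the empty list [].
    A vector of the (algebraic) Fock space is a finite formal linear
    combination of basis tensors, represented as a list of (coefficient, tensor)
    pairs (repetitions are summed). *)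
Definition wm_tensor := list nat.
Definition wm_vec := list (R * wm_tensor).

Definition ann_basis (i : nat) (w : wm_tensor) : option wm_tensor :=
  match w with
  | [] => None
  | j :: w' => if Nat.eqb i j then Some w' else None
  end.

Definition cre_basis (i : nat) (w : wm_tensor) : option wm_tensor :=
  match w with
  | [] => Some [i]
  | j :: _ => if Nat.leb j i then Some (i :: w) else None
  end.

(** Linear extension of a partial map on basis tensors (None = zero vector). *)
Definition lin_ext (f : wm_tensor -> option wm_tensor) (v : wm_vec) : wm_vec :=
  flat_map (fun cw => match f (snd cw) with
                      | Some w' => [(fst cw, w')]
                      | None => []
                      end) v.

Definition A_op (i : nat) : wm_vec -> wm_vec := lin_ext (ann_basis i).
Definition Adag_op (i : nat) : wm_vec -> wm_vec := lin_ext (cre_basis i).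

(** Position operator G_i = A_i + A_i^dag (sum of vectors = concatenation). *)
Definition G_op (i : nat) (v : wm_vec) : wm_vec := A_op i v ++ Adag_op i v.

Definition Omega_vec : wm_vec := [(1, [])].

(** <Omega, v> : coefficient of the vacuum (basis is orthonormal). *)
Definition vac_inner (v : wm_vec) : R :=
  fold_right Rplus 0
    (map (fun cw => match snd cw with [] => fst cw | _ :: _ => 0 end) v).

Definition G12 (v : wm_vec) : wm_vec := G_op 1 v ++ G_op 2 v.

Definition vacuum_moment (n : nat) : R :=
  vac_inner (Nat.iter n G12 Omega_vec).

Definition rho (x : R) : R :=
  if Rle_dec (Rabs x) 2 then
    / (4 * PI) * (sqrt (sqrt (100 - 16 * x ^ 2) - x ^ 2 + 10) - sqrt (4 - x ^ 2))
  else if Rle_dec (Rabs x) (5 / 2) then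
    / (4 * PI) * sqrt (- 2 * x ^ 2 - 2 * Rabs x * sqrt (x ^ 2 - 4) + 20)
  else 0.

(* Main.v *)
Require Import Defs.
From Stdlib Require Import Reals List Arith Lra Lia.
From Coquelicot Require Import Coquelicot.
Open Scope R_scope.

(** On the tensors [e_2^a (x) e_1^b] the operator [G_1 + G_2] is the adjacency
    operator of a comb graph: a half-line with a half-line attached at each
    vertex. Counting its closed walks through their trace on the spine gives
    [m_n = sum_j b(n,j) b(j,0)], where [b] counts walks on the half-line. Since
    [x^n = sum_j b(n,j) U_j(x)] with [U_j] the Chebyshev polynomials of [[-2,2]],
    it suffices that [rho] integrates [U_j] to the [j]-th semicircle moment
    [b(j,0)].

    With [x = w + 1/w], [w] running through the upper unit half-circle and the
    segments [[1,2]] and [[-2,-1]], one has [U_j(x) dx = (w^j - w^(-j-2)) dw], and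
    [rho] is, up to the semicircle density, [Im S / (2 pi)] for
    [S = sqrt(w^2 - 4)]. The primitive [w^(r-1) S^3] links the integrals of
    [w^r S] and [w^(r-2) S] by the recursion of the semicircle moments; the
    boundary terms vanish because [S = 0] at [w = 2]. *)

(** * Walks on the comb *)

(* Number of [n]-step walks from [0] to [j] on the half-line. *)
Fixpoint ballot (n j : nat) : R :=
  match n with
  | O => match j with O => 1 | S _ => 0 end
  | S n' => match j with
            | O => ballot n' 1
            | S j' => ballot n' j' + ballot n' (S (S j'))
            end
  end.

Lemma ballot_above n j : (n < j)%nat -> ballot n j = 0.
Proof.
  revert j; induction n as [|n IH]; intros [|j] H; try lia; simpl; [reflexivity|].
  rewrite !IH by lia; lra.
Qed.

(* Ratio of consecutive entries in [(j+1)/(n+1) C(n+1, (n-j)/2)], the ballot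
   number for [n = j mod 2]; both sides vanish for the other parity. *)
Lemma ballot_contiguous n j :
  (INR j + 1) * (INR n + INR j + 4) * ballot n (S (S j)) =
  (INR j + 3) * (INR n - INR j) * ballot n j.
Proof.
  revert j; induction n as [|n IH]; intros j.
  - destruct j; simpl; lra.
  - pose proof (pos_INR n) as Hn.
    destruct j as [|j].
    + pose proof (IH 1%nat) as H1; rewrite S_INR in *; simpl in *; nra.
    + pose proof (IH j) as H1; pose proof (IH (S (S j))) as H2.
      pose proof (pos_INR j) as Hj.
      rewrite !S_INR in *; simpl ballot.
      (* All three entries of row [n] that occur are expressed through [ballot n j], so the claim
         becomes a rational identity. *)
      assert (E1 : ballot n (S (S j)) =
        (INR j + 3) * (INR n - INR j) / ((INR j + 1) * (INR n + INR j + 4)) * ballot n j).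
      { apply (Rmult_eq_reg_l ((INR j + 1) * (INR n + INR j + 4))); [|nra].
        rewrite H1; field; lra. }
      assert (E2 : ballot n (S (S (S (S j)))) =
        (INR j + 5) * (INR n - INR j - 2) / ((INR j + 3) * (INR n + INR j + 6))
          * ballot n (S (S j))).
      { apply (Rmult_eq_reg_l ((INR j + 3) * (INR n + INR j + 6))); [|nra].
        replace ((INR j + 3) * (INR n + INR j + 6)) with
          ((INR j + 1 + 1 + 1) * (INR n + (INR j + 1 + 1) + 4)) by ring.
        rewrite H2; field; lra. }
      rewrite E2, E1; field; lra.
Qed.

(** A return in [n + 2] steps ends in [ballot n 0 + ballot n 2], and the contiguity relation at
    [j = 0] eliminates [ballot n 2]. This is the Catalan recursion. *)
Lemma ballot_return_rec n :
  (INR n + 4) * ballot (S (S n)) 0 = 4 * (INR n + 1) * ballot n 0.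
Proof.
  pose proof (ballot_contiguous n 0) as H; simpl in *; lra.
Qed.

Lemma ballot_return_odd k : ballot (2 * k + 1) 0 = 0.
Proof.
  induction k as [|k IH]; [simpl; lra|].
  pose proof (ballot_return_rec (2 * k + 1)) as H; rewrite IH in H.
  replace (2 * S k + 1)%nat with (S (S (2 * k + 1))) by lia.
  pose proof (pos_INR (2 * k + 1)); nra.
Qed.

(** Vectors are unreduced lists with repetitions; linear functionals do not see the difference, so
    the operators are studied by transposition. *)
Definition pairing (f : wm_tensor -> R) (v : wm_vec) : R :=
  fold_right Rplus 0 (map (fun cw => fst cw * f (snd cw)) v).

Definition opt_eval (f : wm_tensor -> R) (o : option wm_tensor) : R :=
  match o with Some w => f w | None => 0 end.

Definition G12_dual (f : wm_tensor -> R) (w : wm_tensor) : R :=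
  (opt_eval f (ann_basis 1 w) + opt_eval f (cre_basis 1 w)) +
  (opt_eval f (ann_basis 2 w) + opt_eval f (cre_basis 2 w)).

Definition vac_indicator (w : wm_tensor) : R :=
  match w with nil => 1 | _ :: _ => 0 end.

Lemma pairing_app f u v : pairing f (u ++ v) = pairing f u + pairing f v.
Proof.
  unfold pairing; induction u as [|x u IH]; simpl; [lra|]; rewrite IH; lra.
Qed.

Lemma pairing_lin_ext f g v :
  pairing f (lin_ext g v) = pairing (fun w => opt_eval f (g w)) v.
Proof.
  induction v as [|[c w] v IH]; [reflexivity|].
  change (lin_ext g ((c, w) :: v)) with
    (match g w with Some w' => (c, w') :: nil | None => nil end ++ lin_ext g v).
  rewrite pairing_app, IH; unfold pairing; simpl.
  destruct (g w); simpl; lra.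
Qed.

Lemma pairing_plus f g v :
  pairing (fun w => f w + g w) v = pairing f v + pairing g v.
Proof.
  unfold pairing; induction v as [|x v IH]; simpl; [lra|]; rewrite IH; lra.
Qed.

Lemma pairing_G12 f v : pairing f (G12 v) = pairing (G12_dual f) v.
Proof.
  unfold G12, G_op, A_op, Adag_op, G12_dual.
  rewrite !pairing_app, !pairing_lin_ext, !pairing_plus; reflexivity.
Qed.

Lemma pairing_iter f n v :
  pairing f (Nat.iter n G12 v) = pairing (Nat.iter n G12_dual f) v.
Proof.
  revert f; induction n as [|n IH]; intros f; [reflexivity|].
  rewrite Nat.iter_succ, pairing_G12, IH, <- Nat.iter_succ_r; reflexivity.
Qed.

Lemma vac_inner_pairing v : vac_inner v = pairing vac_indicator v.
Proof.
  unfold vac_inner, pairing; f_equal; apply map_ext.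
  intros [c [|j w]]; simpl; lra.
Qed.

Lemma vacuum_moment_dual n :
  vacuum_moment n = Nat.iter n G12_dual vac_indicator nil.
Proof.
  unfold vacuum_moment; rewrite vac_inner_pairing, pairing_iter.
  unfold pairing, Omega_vec; simpl; lra.
Qed.

(** Vertex of the comb: height [a] on the tooth attached at position [b] of the spine. *)
Definition comb_tensor (a b : nat) : wm_tensor := repeat 2%nat a ++ repeat 1%nat b.

(** With a 2 in front, the index 1 can be neither created nor annihilated, so only the two moves
    along the tooth remain. *)
Lemma G12_dual_comb_tooth f a b :
  G12_dual f (comb_tensor (S a) b) =
  f (comb_tensor a b) + f (comb_tensor (S (S a)) b).
Proof. unfold G12_dual, comb_tensor; simpl; lra. Qed.

Lemma G12_dual_comb_root f :
  G12_dual f (comb_tensor 0 0) = f (comb_tensor 1 0) + f (comb_tensor 0 1).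
Proof. unfold G12_dual, comb_tensor; simpl; lra. Qed.

Lemma G12_dual_comb_spine f b :
  G12_dual f (comb_tensor 0 (S b)) =
  f (comb_tensor 1 (S b)) + (f (comb_tensor 0 b) + f (comb_tensor 0 (S (S b)))).
Proof. unfold G12_dual, comb_tensor; simpl; lra. Qed.

(* [i] is the length of the walk along the spine, [a + i] the net number of
   tooth steps still to be undone. *)
Lemma comb_walks n : forall K a b, (n <= K)%nat ->
  Nat.iter n G12_dual vac_indicator (comb_tensor a b) =
  sum_f_R0 (fun i => ballot n (a + i) * ballot i b) K.
Proof.
  induction n as [|n IH]; intros K a b HK.
  - simpl.
    assert (E : forall K, sum_f_R0 (fun i => ballot 0 (a + i) * ballot i b) K =
                          ballot 0 a * ballot 0 b).
    { clear K HK; intros K; induction K as [|K IHK]; simpl in *.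
      - rewrite Nat.add_0_r; reflexivity.
      - rewrite IHK, Nat.add_succ_r; lra. }
    simpl in E; rewrite E; destruct a, b; simpl; lra.
  - rewrite Nat.iter_succ; destruct a as [|a].
    + destruct K as [|K]; [lia|].
      (* The first sum is the step into the tooth. The steps along the spine merge into the second
         by the recursion of [ballot (S i) b]; shifting its index turns the total into row [S n]. *)
      transitivity (sum_f_R0 (fun i => ballot n (1 + i) * ballot i b) (S K) +
                    sum_f_R0 (fun i => ballot n (0 + i) * ballot (S i) b) K).
      * destruct b as [|b].
        -- rewrite G12_dual_comb_root.
           rewrite (IH (S K) 1%nat) by lia; rewrite (IH K 0%nat) by lia; reflexivity.
        -- rewrite G12_dual_comb_spine.
           rewrite (IH (S K) 1%nat), !(IH K 0%nat), <- plus_sum by lia; f_equal.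
           apply sum_eq; intros i _; simpl; ring.
      * rewrite (decomp_sum (fun i => ballot (S n) (0 + i) * ballot i b) (S K)),
          (decomp_sum (fun i => ballot n (1 + i) * ballot i b) (S K)) by lia.
        simpl pred.
        rewrite Rplus_assoc, <- plus_sum; f_equal.
        apply sum_eq; intros i _; simpl; ring.
    + rewrite G12_dual_comb_tooth, !(IH K), <- plus_sum by lia.
      apply sum_eq; intros i _; simpl; ring.
Qed.

Lemma vacuum_moment_ballot n :
  vacuum_moment n = sum_f_R0 (fun j => ballot n j * ballot j 0) n.
Proof.
  rewrite vacuum_moment_dual; exact (comb_walks n n 0 0 (le_n n)).
Qed.

(** * Chebyshev polynomials *)

Fixpoint chebU_pair (j : nat) (x : R) : R * R :=
  match j with
  | O => (1, x)
  | S j' => let (u, v) := chebU_pair j' x in (v, x * v - u)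
  end.

(* Chebyshev polynomial normalised so that [U_j(2 cos t) sin t = sin((j+1) t)]. *)
Definition chebU (j : nat) (x : R) : R := fst (chebU_pair j x).

Lemma chebU_rec j x : chebU (S (S j)) x = x * chebU (S j) x - chebU j x.
Proof. unfold chebU; simpl; destruct (chebU_pair j x); reflexivity. Qed.

Lemma chebU_0 x : chebU 0 x = 1.
Proof. reflexivity. Qed.

Lemma chebU_1 x : chebU 1 x = x.
Proof. reflexivity. Qed.

Lemma chebU_ind (P : nat -> R -> Prop) :
  (forall x, P 0%nat x) -> (forall x, P 1%nat x) ->
  (forall j x, P j x -> P (S j) x -> P (S (S j)) x) -> forall j x, P j x.
Proof.
  intros H0 H1 HS j x.
  enough (P j x /\ P (S j) x) by tauto.
  induction j as [|j [IH1 IH2]]; auto.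
Qed.

(** By [x U_j = U_(j-1) + U_(j+1)], multiplication by [x] is the adjacency operator of the
    half-line. The bound [K] is free because the induction uses it at two values. *)
Lemma pow_chebU n x : forall K, (n <= K)%nat ->
  x ^ n = sum_f_R0 (fun j => ballot n j * chebU j x) K.
Proof.
  induction n as [|n IH]; intros K HK.
  - induction K as [|K IHK].
    + simpl; rewrite chebU_0; ring.
    + change (x ^ 0 = sum_f_R0 (fun j => ballot 0 j * chebU j x) K + 0 * chebU (S K) x).
      rewrite <- IHK by lia; ring.
  - destruct K as [|K]; [lia|].
    change (x ^ S n) with (x * x ^ n).
    rewrite (decomp_sum _ (S K)) by lia; simpl pred.
    transitivity (sum_f_R0 (fun i => ballot n i * chebU (S i) x) K +
                  sum_f_R0 (fun i => ballot n (S i) * chebU i x) (S K)).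
    + rewrite (IH (S K)) by lia.
      rewrite (decomp_sum _ (S K)) by lia; simpl pred.
      rewrite (tech5 _ K), (ballot_above n (S (S K))) by lia.
      rewrite chebU_0, Rmult_plus_distr_l, scal_sum.
      transitivity (ballot n 0 * x + sum_f_R0 (fun i => ballot n (S i) * chebU (S (S i)) x
         + ballot n (S i) * chebU i x) K).
      * f_equal; [ring|]; apply sum_eq; intros i _; rewrite chebU_rec; ring.
      * rewrite plus_sum.
        assert (E : sum_f_R0 (fun i => ballot n i * chebU (S i) x) K =
          ballot n 0 * x + sum_f_R0 (fun i => ballot n (S i) * chebU (S (S i)) x) K).
        { transitivity (sum_f_R0 (fun i => ballot n i * chebU (S i) x) (S K)).
          - rewrite tech5, (ballot_above n (S K)) by lia; ring.
          - rewrite decomp_sum by lia; rewrite chebU_1; reflexivity. }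
        rewrite E; ring.
    + rewrite Rplus_comm, (decomp_sum _ (S K)) by lia; simpl pred.
      rewrite Rplus_assoc, <- plus_sum; f_equal.
      apply sum_eq; intros i _; simpl; ring.
Qed.

Lemma chebU_opp j x : chebU j (- x) = (-1) ^ j * chebU j x.
Proof.
  revert j x; apply chebU_ind; intros.
  - rewrite !chebU_0; ring.
  - rewrite !chebU_1; ring.
  - rewrite !chebU_rec, H, H0; simpl; ring.
Qed.

Lemma chebU_trig j t : chebU j (2 * cos t) * sin t = sin ((INR j + 1) * t).
Proof.
  enough (H : forall j x, forall t, x = 2 * cos t ->
            chebU j x * sin t = sin ((INR j + 1) * t)) by (apply H; reflexivity).
  clear; apply (chebU_ind (fun j x => forall t, x = 2 * cos t ->
            chebU j x * sin t = sin ((INR j + 1) * t))).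
  - intros x t _; rewrite chebU_0; simpl; rewrite Rplus_0_l, !Rmult_1_l; reflexivity.
  - intros x t ->; rewrite chebU_1; simpl.
    replace ((1 + 1) * t) with (2 * t) by ring; rewrite sin_2a; ring.
  - intros j x H0 H1 t Hx.
    rewrite chebU_rec, Rmult_minus_distr_r, Rmult_assoc, (H0 _ Hx), (H1 _ Hx), Hx, !S_INR.
    replace ((INR j + 1 + 1 + 1) * t) with ((INR j + 1 + 1) * t + t) by ring.
    replace ((INR j + 1) * t) with ((INR j + 1 + 1) * t - t) by ring.
    rewrite sin_plus, sin_minus; ring.
Qed.

(** Counterpart of [chebU_trig] for real [w]; with [dx = (w - 1/w) dw / w] it gives
    [U_j(x) dx = (w^j - w^(-j-2)) dw]. *)
Lemma chebU_joukowski j w : w <> 0 ->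
  chebU j (w + / w) * (w - / w) = w ^ S j - (/ w) ^ S j.
Proof.
  intros Hw.
  enough (H : forall j x, x = w + / w -> chebU j x * (w - / w) = w ^ S j - (/ w) ^ S j)
    by (apply H; reflexivity).
  clear j; apply (chebU_ind (fun j x => x = w + / w ->
            chebU j x * (w - / w) = w ^ S j - (/ w) ^ S j)).
  - intros x _; rewrite chebU_0; ring.
  - intros x ->; rewrite chebU_1; ring.
  - intros j x H0 H1 Hx.
    rewrite chebU_rec, Rmult_minus_distr_r, Rmult_assoc, (H0 Hx), (H1 Hx), Hx.
    simpl; field; assumption.
Qed.

(** * Contour integrals of [w^r S] *)

(* [S = br_re t + i br_im t] is the square root of [e^(2it) - 4] with positive
   imaginary part, and [br_mod t = |S|^2]. *)
Definition br_mod (t : R) : R := sqrt (25 - 16 * cos t ^ 2).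
Definition br_im (t : R) : R := sqrt ((br_mod t + 5 - 2 * cos t ^ 2) / 2).
Definition br_re (t : R) : R := sin t * cos t / br_im t.

(* [auto_derive] states equations in a carrier convertible to [R], on which [ring] fails. *)
Ltac real_eq := match goal with |- @eq _ ?x ?y => change (@eq R x y) end.

Lemma sin_sq t : sin t ^ 2 = 1 - cos t ^ 2.
Proof. pose proof (sin2_cos2 t); unfold Rsqr in *; nra. Qed.

Lemma cos_sq_le t : cos t ^ 2 <= 1.
Proof. pose proof (sin_sq t); nra. Qed.

Lemma br_mod_sq t : br_mod t ^ 2 = 25 - 16 * cos t ^ 2.
Proof. apply pow2_sqrt; pose proof (cos_sq_le t); lra. Qed.

Lemma br_mod_ge t : 3 <= br_mod t.
Proof.
  rewrite <- (sqrt_pow2 3) by lra; apply sqrt_le_1_alt.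
  pose proof (cos_sq_le t); lra.
Qed.

Lemma br_im_sq t : br_im t ^ 2 = (br_mod t + 5 - 2 * cos t ^ 2) / 2.
Proof. apply pow2_sqrt; pose proof (cos_sq_le t); pose proof (br_mod_ge t); lra. Qed.

Lemma br_im_pos t : 0 < br_im t.
Proof. apply sqrt_lt_R0; pose proof (cos_sq_le t); pose proof (br_mod_ge t); lra. Qed.

Lemma br_re_im t : br_re t * br_im t = sin t * cos t.
Proof. unfold br_re; field; pose proof (br_im_pos t); lra. Qed.

Lemma br_re_sq t : br_re t ^ 2 = (br_mod t - 5 + 2 * cos t ^ 2) / 2.
Proof.
  pose proof (br_im_pos t); apply (Rmult_eq_reg_r (br_im t ^ 2)); [|nra].
  rewrite <- Rpow_mult_distr, br_re_im, br_im_sq, Rpow_mult_distr, sin_sq.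
  pose proof (br_mod_sq t); nra.
Qed.

Lemma is_derive_br_mod t : is_derive br_mod t (16 * sin t * cos t / br_mod t).
Proof.
  pose proof (br_mod_ge t) as HR; unfold br_mod at 1; auto_derive.
  - pose proof (cos_sq_le t); simpl in *; lra.
  - replace (sqrt _) with (br_mod t) by (unfold br_mod; f_equal; simpl; ring).
    field; lra.
Qed.

(** Imaginary part of [S' = i e^(2it) / S = i S + 4 i conj(S) / |S|^2]; the real part is
    [is_derive_br_re]. *)
Lemma is_derive_br_im t :
  is_derive br_im t (br_re t * (4 + br_mod t) / br_mod t).
Proof.
  pose proof (br_mod_ge t) as HR; pose proof (br_im_pos t) as Hq.
  pose proof (br_im_sq t) as Hq2.
  replace (br_re t * (4 + br_mod t) / br_mod t) with
    ((16 * sin t * cos t / br_mod t + 4 * sin t * cos t) / (2 * 2 * br_im t)).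
  2: { unfold br_re; field; lra. }
  unfold br_im at 1; auto_derive.
  - split; [exists (16 * sin t * cos t / br_mod t); apply is_derive_br_mod|].
    split; [|trivial]; simpl in *; nra.
  - change (Derive (fun x => br_mod x) t) with (Derive br_mod t).
    rewrite (is_derive_unique _ _ _ (is_derive_br_mod t)).
    replace (sqrt _) with (br_im t) by (unfold br_im; f_equal; simpl; field).
    field; lra.
Qed.

Lemma is_derive_br_re t :
  is_derive br_re t (br_im t * (4 - br_mod t) / br_mod t).
Proof.
  pose proof (br_mod_ge t) as HR; pose proof (br_im_pos t) as Hq.
  pose proof (br_im_sq t) as Hq2; pose proof (br_mod_sq t) as HR2.
  pose proof (sin_sq t) as Hs.
  unfold br_re at 1; auto_derive.
  - split; [exists (br_re t * (4 + br_mod t) / br_mod t); apply is_derive_br_im|].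
    split; [lra|trivial].
  - change (Derive (fun x => br_im x) t) with (Derive br_im t).
    rewrite (is_derive_unique _ _ _ (is_derive_br_im t)).
    unfold br_re.
    set (q := br_im t) in *; set (r := br_mod t) in *; set (c := cos t) in *;
    set (s := sin t) in *.
    apply (Rmult_eq_reg_r (q ^ 3 * r)); [|apply Rmult_integral_contrapositive; split; nra].
    transitivity (q ^ 2 * r * (c ^ 2 - s ^ 2) - s ^ 2 * c ^ 2 * (4 + r)).
    { field; lra. }
    transitivity ((q ^ 2) ^ 2 * (4 - r)).
    2: { field; lra. }
    rewrite Hs, Hq2.
    replace (c ^ 2) with ((25 - r ^ 2) / 16) by lra; field.
Qed.

Lemma ex_derive_br_im t : ex_derive br_im t.
Proof. eexists; apply is_derive_br_im. Qed.

Lemma ex_derive_br_re t : ex_derive br_re t.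
Proof. eexists; apply is_derive_br_re. Qed.

(** * Recursion in the exponent on the arc and on the segment *)

Lemma is_RInt_primitive (F f : R -> R) a b : a <= b ->
  (forall x, a <= x <= b -> is_derive F x (f x)) ->
  (forall x, a <= x <= b -> ex_derive f x) ->
  is_RInt f a b (F b - F a).
Proof.
  intros Hab HF Hf.
  apply (is_RInt_derive F f a b); rewrite Rmin_left, Rmax_right by exact Hab; auto.
  intros x Hx; apply (ex_derive_continuous (V := R_NormedModule)), Hf, Hx.
Qed.

(** Real and imaginary parts of [S^3], whose derivative [3 i e^(2it) S] is free of denominators. *)
Definition br_cube_re (t : R) : R := br_re t ^ 3 - 3 * br_re t * br_im t ^ 2.
Definition br_cube_im (t : R) : R := 3 * br_re t ^ 2 * br_im t - br_im t ^ 3.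

Lemma is_derive_br_cube_re t : is_derive br_cube_re t
  (- 3 * (2 * sin t * cos t * br_re t + (2 * cos t ^ 2 - 1) * br_im t)).
Proof.
  unfold br_cube_re; auto_derive.
  - repeat split; auto using ex_derive_br_re, ex_derive_br_im.
  - change (Derive (fun x => br_re x) t) with (Derive br_re t).
    change (Derive (fun x => br_im x) t) with (Derive br_im t).
    rewrite (is_derive_unique _ _ _ (is_derive_br_re t)).
    rewrite (is_derive_unique _ _ _ (is_derive_br_im t)).
    pose proof (br_mod_ge t) as HR; pose proof (br_im_sq t) as Hq.
    pose proof (br_re_sq t) as Hp; pose proof (br_re_im t) as Hpq.
    rewrite (Rmult_assoc 2), <- Hpq.
    replace (2 * cos t ^ 2) with (5 + br_re t ^ 2 - br_im t ^ 2) by lra.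
    replace (br_mod t) with (br_re t ^ 2 + br_im t ^ 2) in * by lra.
    field; lra.
Qed.

Lemma is_derive_br_cube_im t : is_derive br_cube_im t
  (3 * ((2 * cos t ^ 2 - 1) * br_re t - 2 * sin t * cos t * br_im t)).
Proof.
  unfold br_cube_im; auto_derive.
  - repeat split; auto using ex_derive_br_re, ex_derive_br_im.
  - change (Derive (fun x => br_re x) t) with (Derive br_re t).
    change (Derive (fun x => br_im x) t) with (Derive br_im t).
    rewrite (is_derive_unique _ _ _ (is_derive_br_re t)).
    rewrite (is_derive_unique _ _ _ (is_derive_br_im t)).
    pose proof (br_mod_ge t) as HR; pose proof (br_im_sq t) as Hq.
    pose proof (br_re_sq t) as Hp; pose proof (br_re_im t) as Hpq.
    rewrite (Rmult_assoc 2 (sin t)), <- Hpq.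
    replace (2 * cos t ^ 2) with (5 + br_re t ^ 2 - br_im t ^ 2) by lra.
    replace (br_mod t) with (br_re t ^ 2 + br_im t ^ 2) in * by lra.
    field; lra.
Qed.

(* [Im (w^r S dw)] for [w = e^(it)] with [t] decreasing, resp. for
   [w = 2 cos f] with [f] decreasing, where [S = 2 i sin f]. *)
Definition arc_integrand (r t : R) : R :=
  sin ((r + 1) * t) * br_im t - cos ((r + 1) * t) * br_re t.

Definition seg_integrand (r f : R) : R :=
  exp (r * ln (2 * cos f)) * (4 * sin f ^ 2).

Lemma ex_derive_arc_integrand r t : ex_derive (arc_integrand r) t.
Proof.
  unfold arc_integrand; auto_derive; repeat split;
  auto using ex_derive_br_re, ex_derive_br_im.
Qed.

Lemma cos_third_pos f : 0 <= f <= PI / 3 -> 0 < cos f.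
Proof. intros H; pose proof PI_RGT_0; apply cos_gt_0; lra. Qed.

Lemma ex_derive_seg_integrand r f : 0 <= f <= PI / 3 -> ex_derive (seg_integrand r) f.
Proof.
  intros H; pose proof (cos_third_pos f H).
  unfold seg_integrand; auto_derive; repeat split; lra.
Qed.

(** Since [S dS = w dw], one has [d(w^(r-1) S^3) = ((r+2) w^r S - 4 (r-1) w^(r-2) S) dw]; the
    imaginary part is integrated from [w = i] to [w = 1]. *)
Lemma arc_recursion r : cos ((r - 1) * (PI / 2)) = 0 ->
  is_RInt (fun t => (r + 2) * arc_integrand r t - 4 * (r - 1) * arc_integrand (r - 2) t)
    0 (PI / 2) (- 3 * sqrt 3).
Proof.
  intros Hr; pose proof PI_RGT_0.
  set (F := fun t => - (cos ((r - 1) * t) * br_cube_im t + sin ((r - 1) * t) * br_cube_re t)).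
  replace (- 3 * sqrt 3) with (F (PI / 2) - F 0).
  - apply is_RInt_primitive; [lra| |].
    + intros t _; unfold F; auto_derive.
      * repeat split; eexists; [apply is_derive_br_cube_im | apply is_derive_br_cube_re].
      * change (Derive (fun x => br_cube_re x) t) with (Derive br_cube_re t).
        change (Derive (fun x => br_cube_im x) t) with (Derive br_cube_im t).
        rewrite (is_derive_unique _ _ _ (is_derive_br_cube_re t)).
        rewrite (is_derive_unique _ _ _ (is_derive_br_cube_im t)).
        unfold arc_integrand.
        replace ((r - 2 + 1) * t) with ((r - 1) * t) by ring.
        replace ((r + 1) * t) with ((r - 1) * t + 2 * t) by ring.
        rewrite sin_plus, cos_plus, sin_2a, cos_2a_cos.
        set (a := sin ((r - 1) * t)); set (b := cos ((r - 1) * t)).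
        unfold br_cube_im, br_cube_re.
        (* Here [S^3] is rewritten as [(e^(2it) - 4) S], in both components. *)
        replace (3 * br_re t ^ 2 * br_im t - br_im t ^ 3) with
          ((2 * cos t ^ 2 - 5) * br_im t + 2 * (sin t * cos t) * br_re t).
        2: { rewrite <- br_re_im.
             replace (2 * cos t ^ 2 - 5) with (br_re t ^ 2 - br_im t ^ 2)
               by (rewrite br_re_sq, br_im_sq; field); ring. }
        replace (br_re t ^ 3 - 3 * br_re t * br_im t ^ 2) with
          ((2 * cos t ^ 2 - 5) * br_re t - 2 * (sin t * cos t) * br_im t).
        2: { rewrite <- br_re_im.
             replace (2 * cos t ^ 2 - 5) with (br_re t ^ 2 - br_im t ^ 2)
               by (rewrite br_re_sq, br_im_sq; field); ring. }
        real_eq; ring.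
    + intros t _; auto_derive; repeat split; apply ex_derive_arc_integrand.
  (* At [w = 1], [S = i sqrt 3]. At [w = i], [S^3] is purely imaginary and its coefficient vanishes
     by [Hr]. *)
  - assert (E0 : br_mod 0 = 3).
    { unfold br_mod; rewrite cos_0; replace (25 - 16 * 1 ^ 2) with (3 ^ 2) by ring.
      apply sqrt_pow2; lra. }
    unfold F, br_cube_im, br_cube_re, br_re, br_im; rewrite Hr, E0, cos_PI2, Rmult_0_r.
    rewrite sin_0, cos_0, Rmult_0_r, sin_0.
    replace ((3 + 5 - 2 * 1 ^ 2) / 2) with 3 by field.
    pose proof (sqrt_sqrt 3 ltac:(lra)) as H3.
    pose proof (sqrt_lt_R0 3 ltac:(lra)).
    replace (sqrt 3 ^ 3) with (3 * sqrt 3) by (rewrite <- H3 at 1; ring).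
    rewrite cos_0; unfold Rdiv; real_eq; ring.
Qed.

(** Same primitive on the segment: it vanishes at [w = 2], and its boundary term at [w = 1] is
    opposite to that of the arc. *)
Lemma seg_recursion r :
  is_RInt (fun t => (r + 2) * seg_integrand r t - 4 * (r - 1) * seg_integrand (r - 2) t)
    0 (PI / 3) (3 * sqrt 3).
Proof.
  pose proof PI_RGT_0.
  set (F := fun t => exp ((r - 1) * ln (2 * cos t)) * (8 * sin t ^ 3)).
  replace (3 * sqrt 3) with (F (PI / 3) - F 0).
  - apply is_RInt_primitive; [lra| |].
    + intros t Ht; pose proof (cos_third_pos t Ht) as Hc.
      unfold F; auto_derive; [repeat split; lra|].
      unfold seg_integrand.
      assert (E : forall k, exp ((k + 1) * ln (2 * cos t)) = exp (k * ln (2 * cos t)) * (2 * cos t)).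
      { intros k; rewrite Rmult_plus_distr_r, exp_plus, Rmult_1_l, exp_ln by lra; reflexivity. }
      assert (E1 := E (r - 2)); assert (E2 := E (r - 2 + 1)).
      replace (r - 2 + 1 + 1) with r in E2 by ring.
      replace (r - 2 + 1) with (r - 1) in E1, E2 by ring.
      rewrite E2, E1.
      set (e := exp ((r - 2) * ln (2 * cos t))); clearbody e.
      real_eq; rewrite !Rminus_def in *.
      replace (sin t ^ 3) with (sin t * (1 - cos t ^ 2)) by (rewrite <- sin_sq; ring).
      field_simplify; [|lra].
      replace (sin t ^ 4) with ((1 - cos t ^ 2) ^ 2) by (rewrite <- sin_sq; ring).
      rewrite sin_sq; ring.
    + intros t Ht; auto_derive; repeat split; apply ex_derive_seg_integrand, Ht.
  - unfold F; rewrite sin_0, cos_PI3, sin_PI3.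
    replace (2 * (1 / 2)) with 1 by field; rewrite ln_1, Rmult_0_r, exp_0.
    replace ((sqrt 3 / 2) ^ 3) with (sqrt 3 * sqrt 3 * sqrt 3 / 8) by field.
    rewrite sqrt_sqrt by lra; real_eq; field.
Qed.

(** * Base values at exponent 0 *)

Lemma seg_base : is_RInt (seg_integrand 0) 0 (PI / 3) (2 * PI / 3 - sqrt 3 / 2).
Proof.
  pose proof PI_RGT_0.
  replace (2 * PI / 3 - sqrt 3 / 2) with
    ((fun t => 2 * t - 2 * sin t * cos t) (PI / 3) - (fun t => 2 * t - 2 * sin t * cos t) 0).
  - apply (is_RInt_primitive (fun t => 2 * t - 2 * sin t * cos t)); [lra| |].
    + intros t _; auto_derive; [trivial|].
      unfold seg_integrand; rewrite Rmult_0_l, exp_0.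
      real_eq; replace (cos t * (1 * - sin t)) with (- (sin t * cos t)) by ring.
      transitivity (2 - 2 * cos t ^ 2 + 2 * sin t ^ 2); [ring|].
      rewrite sin_sq; ring.
    + intros t Ht; apply ex_derive_seg_integrand, Ht.
  - rewrite sin_0, cos_PI3, sin_PI3; real_eq; field.
Qed.

(** Linear in [sin t * br_im t] and [cos t * br_re t]; multiplied by [br_im t] it reduces to
    [25 - br_mod t ^ 2 = 16 cos t ^ 2]. *)
Lemma br_quarter t :
  sin t * br_im t * (5 - br_mod t) = cos t * br_re t * (br_mod t + 3).
Proof.
  pose proof (br_im_pos t); apply (Rmult_eq_reg_r (br_im t)); [|lra].
  transitivity (sin t * (br_im t ^ 2 * (5 - br_mod t))); [ring|].
  transitivity (cos t * (br_re t * br_im t) * (br_mod t + 3)); [|ring].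
  rewrite br_re_im, br_im_sq.
  replace ((br_mod t + 5 - 2 * cos t ^ 2) / 2 * (5 - br_mod t)) with
    ((25 - br_mod t ^ 2 - 2 * cos t ^ 2 * (5 - br_mod t)) / 2) by field.
  rewrite br_mod_sq; field.
Qed.

(* The primitive of [S dw] is [w S / 2 - 2 log (w + S)]; here is the derivative
   of the cotangent of the argument of [w + S]. *)
Lemma br_arg_identity t :
  let a := cos t + br_re t in let b := sin t + br_im t in
  let a' := - sin t + br_im t * (4 - br_mod t) / br_mod t in
  let b' := cos t + br_re t * (4 + br_mod t) / br_mod t in
  a' * b - a * b' =
  - (cos t * br_re t + sin t * br_im t) * (a ^ 2 + b ^ 2) / br_mod t.
Proof.
  intros a b a' b'; unfold a', b', a, b; clear a b a' b'.
  pose proof (br_mod_ge t) as HR; pose proof (br_im_sq t) as Hq.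
  pose proof (br_re_sq t) as Hp; pose proof (br_re_im t) as Hpq.
  pose proof (br_quarter t) as Hk; pose proof (br_mod_sq t) as HR2.
  pose proof (sin_sq t) as Hs.
  set (q := br_im t) in *; set (p := br_re t) in *; set (R := br_mod t) in *;
  set (s := sin t) in *; set (c := cos t) in *.
  clearbody q p R s c.
  assert (HK : 2 * (c * p + s * q) ^ 2 = R + 5 - 8 * c ^ 2).
  { transitivity (2 * (c ^ 2 * p ^ 2 + s ^ 2 * q ^ 2 + 2 * (s * c) * (p * q))); [ring|].
    rewrite Hpq. transitivity (2 * (c ^ 2 * p ^ 2 + s ^ 2 * q ^ 2 + 2 * s ^ 2 * c ^ 2)); [ring|].
    rewrite Hp, Hq, Hs; field. }
  assert (Hn : (c + p) ^ 2 + (s + q) ^ 2 = 1 + R + 2 * (c * p + s * q)).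
  { transitivity (c ^ 2 + s ^ 2 + p ^ 2 + q ^ 2 + 2 * (c * p + s * q)); [ring|].
    rewrite Hs, Hp, Hq; field. }
  apply (Rmult_eq_reg_r R); [|lra].
  transitivity (- R * ((c + p) ^ 2 + (s + q) ^ 2) +
                4 * (s * q - c * p + q ^ 2 - p ^ 2)); [field; lra|].
  transitivity (- (c * p + s * q) * ((c + p) ^ 2 + (s + q) ^ 2)); [|field; lra].
  (* Modulo [HK] and [HR2], the difference of the two sides is exactly that of [Hk]. *)
  rewrite Hn, Hq, Hp; nra.
Qed.

Lemma arc_base : is_RInt (arc_integrand 0) 0 (PI / 2) (PI / 3 + sqrt 3 / 2).
Proof.
  pose proof PI_RGT_0.
  (* Up to a constant, [- Im (w S / 2 - 2 log (w + S))]. The cotangent is used because [Im (w + S)]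
     stays positive, while [Re (w + S)] vanishes at [w = i]. *)
  set (F := fun t => - (sin t * br_re t + cos t * br_im t) / 2
    - 2 * atan ((cos t + br_re t) / (sin t + br_im t))).
  replace (PI / 3 + sqrt 3 / 2) with (F (PI / 2) - F 0).
  - apply is_RInt_primitive; [lra| |].
    + intros t Ht; pose proof (br_im_pos t) as Hq; pose proof (br_mod_ge t) as HR.
      assert (Hs : 0 <= sin t) by (apply sin_ge_0; lra).
      unfold F; auto_derive.
      * repeat split; auto using ex_derive_br_re, ex_derive_br_im; lra.
      * change (Derive (fun x => br_re x) t) with (Derive br_re t).
        change (Derive (fun x => br_im x) t) with (Derive br_im t).
        rewrite (is_derive_unique _ _ _ (is_derive_br_re t)).
        rewrite (is_derive_unique _ _ _ (is_derive_br_im t)).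
        unfold arc_integrand; replace ((0 + 1) * t) with t by ring.
        pose proof (br_arg_identity t) as HI; cbv zeta in HI.
        set (a := cos t + br_re t) in *; set (b := sin t + br_im t) in *.
        assert (Hb : 0 < b) by (unfold b; lra).
        set (a' := - sin t + br_im t * (4 - br_mod t) / br_mod t) in *.
        set (b' := cos t + br_re t * (4 + br_mod t) / br_mod t) in *.
        assert (HD : (a' * b - a * b') / (a ^ 2 + b ^ 2) =
                     - (cos t * br_re t + sin t * br_im t) / br_mod t).
        { rewrite HI; field; split; apply Rgt_not_eq; nra. }
        real_eq.
        transitivity (- (cos t * br_re t + sin t * (br_im t * (4 - br_mod t) / br_mod t)
           - sin t * br_im t + cos t * (br_re t * (4 + br_mod t) / br_mod t)) / 2
           - 2 * ((a' * b - a * b') / (a ^ 2 + b ^ 2))).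
        { unfold a', b'; field; repeat split; nra. }
        rewrite HD; field; lra.
    + intros t _; apply ex_derive_arc_integrand.
  - assert (E0 : br_mod 0 = 3).
    { unfold br_mod; rewrite cos_0; replace (25 - 16 * 1 ^ 2) with (3 ^ 2) by ring.
      apply sqrt_pow2; lra. }
    pose proof (br_im_pos (PI / 2)).
    unfold F, br_re; rewrite sin_PI2, cos_PI2, sin_0, cos_0.
    (* Only the occurrences at [t = 0] are unfolded; [br_im (PI / 2)] cancels without being
       evaluated. *)
    unfold br_im at 5 6 7 8; rewrite E0, cos_0.
    replace ((3 + 5 - 2 * 1 ^ 2) / 2) with 3 by field.
    replace ((0 + 1 * 0 / br_im (PI / 2)) / (1 + br_im (PI / 2))) with 0 by (field; lra).
    replace ((1 + 0 * 1 / sqrt 3) / (0 + sqrt 3)) with (tan (PI / 6))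
      by (rewrite tan_PI6; field; apply Rgt_not_eq, sqrt_lt_R0; lra).
    rewrite atan_0, atan_tan by lra; real_eq; field.
    pose proof (sqrt_lt_R0 3 ltac:(lra)); lra.
Qed.

(* The contour runs from [i] to [1] on the unit circle, then to [2]. *)
Definition contour_int (r : R) : R :=
  RInt (arc_integrand r) 0 (PI / 2) + RInt (seg_integrand r) 0 (PI / 3).

Lemma ex_RInt_derivable (f : R -> R) a b : a <= b ->
  (forall x, a <= x <= b -> ex_derive f x) -> ex_RInt f a b.
Proof.
  intros Hab Hf; apply (ex_RInt_continuous (V := R_CompleteNormedModule)).
  rewrite Rmin_left, Rmax_right by exact Hab.
  intros x Hx; apply (ex_derive_continuous (V := R_NormedModule)), Hf, Hx.
Qed.

Lemma is_RInt_arc r : is_RInt (arc_integrand r) 0 (PI / 2) (RInt (arc_integrand r) 0 (PI / 2)).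
Proof.
  pose proof PI_RGT_0; apply (RInt_correct (V := R_CompleteNormedModule)).
  apply ex_RInt_derivable; [lra|]; intros; apply ex_derive_arc_integrand.
Qed.

Lemma is_RInt_seg r : is_RInt (seg_integrand r) 0 (PI / 3) (RInt (seg_integrand r) 0 (PI / 3)).
Proof.
  pose proof PI_RGT_0; apply (RInt_correct (V := R_CompleteNormedModule)).
  apply ex_RInt_derivable; [lra|]; intros; apply ex_derive_seg_integrand; assumption.
Qed.

(** * Contour integrals at even exponents *)

Lemma is_RInt_lin2 (f g : R -> R) a b k l u v :
  is_RInt f a b u -> is_RInt g a b v ->
  is_RInt (fun x => k * f x - l * g x) a b (k * u - l * v).
Proof.
  intros Hf Hg.
  exact (is_RInt_minus _ _ _ _ _ _ (is_RInt_scal _ _ _ k _ Hf) (is_RInt_scal _ _ _ l _ Hg)).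
Qed.

Lemma is_RInt_value (f : R -> R) a b u v : is_RInt f a b u -> is_RInt f a b v -> u = v.
Proof.
  intros Hu Hv.
  rewrite <- (is_RInt_unique (V := R_CompleteNormedModule) _ _ _ _ Hu).
  exact (is_RInt_unique (V := R_CompleteNormedModule) _ _ _ _ Hv).
Qed.

(* The hypothesis on [r] makes the boundary term at [w = i] vanish. *)
Lemma contour_recursion r : cos ((r - 1) * (PI / 2)) = 0 ->
  (r + 2) * contour_int r = 4 * (r - 1) * contour_int (r - 2).
Proof.
  intros Hr; unfold contour_int.
  pose proof (is_RInt_value _ _ _ _ _ (arc_recursion r Hr)
    (is_RInt_lin2 _ _ _ _ _ _ _ _ (is_RInt_arc r) (is_RInt_arc (r - 2)))).
  pose proof (is_RInt_value _ _ _ _ _ (seg_recursion r)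
    (is_RInt_lin2 _ _ _ _ _ _ _ _ (is_RInt_seg r) (is_RInt_seg (r - 2)))).
  lra.
Qed.

(** Even exponents [r = 2k] satisfy the hypothesis of [contour_recursion]; [k] is an integer to
    cover negative exponents. *)
Lemma cos_odd_half_PI k : cos ((2 * IZR k - 1) * (PI / 2)) = 0.
Proof.
  replace ((2 * IZR k - 1) * (PI / 2)) with (- (PI / 2 - IZR k * PI)) by field.
  rewrite cos_neg, cos_shift; apply sin_eq_0_1; exists k; reflexivity.
Qed.

Lemma contour_0 : contour_int 0 = PI.
Proof.
  unfold contour_int.
  rewrite (is_RInt_value _ _ _ _ _ (is_RInt_arc 0) arc_base).
  rewrite (is_RInt_value _ _ _ _ _ (is_RInt_seg 0) seg_base); lra.
Qed.

(** [contour_recursion] at [r = 2k + 2] coincides with [ballot_return_rec]. *)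
Lemma contour_even k : contour_int (2 * INR k) = PI * ballot (2 * k) 0.
Proof.
  induction k as [|k IH].
  - simpl; rewrite Rmult_0_r, contour_0; ring.
  - pose proof (contour_recursion (2 * INR (S k))) as H.
    rewrite (INR_IZR_INZ (S k)) in H at 1; specialize (H (cos_odd_half_PI _)).
    replace (2 * INR (S k) - 2) with (2 * INR k) in H by (rewrite S_INR; ring).
    rewrite IH in H.
    pose proof (ballot_return_rec (2 * k)) as Hb.
    replace (2 * S k)%nat with (S (S (2 * k))) by lia.
    rewrite mult_INR in Hb; rewrite S_INR in *; simpl (INR 2) in Hb.
    pose proof (pos_INR k).
    apply (Rmult_eq_reg_l (2 * (INR k + 1) + 2)); [|lra].
    rewrite H; replace (2 * (INR k + 1) + 2) with (2 * INR k + 4) by ring.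
    transitivity (PI * (4 * (2 * INR k + 1) * ballot (2 * k) 0)); [ring|].
    transitivity (PI * ((2 * INR k + 4) * ballot (S (S (2 * k))) 0)); [|ring].
    f_equal; symmetry; exact Hb.
Qed.

Lemma contour_minus_2 : contour_int (-2) = - PI / 2.
Proof.
  pose proof (contour_recursion 0) as H.
  replace (0 - 1) with (2 * IZR 0 - 1) in H at 1 by ring.
  specialize (H (cos_odd_half_PI _)); rewrite contour_0 in H.
  replace (0 - 2) with (-2) in H by ring; lra.
Qed.

(** At [r = -2] the factor [r + 2] vanishes, so the integral at exponent -4 is zero; the recursion
    carries this zero downwards. *)
Lemma contour_negative k : contour_int (- (2 * INR (S k)) - 2) = 0.
Proof.
  assert (H : forall k : nat, - (2 * INR k) * contour_int (- (2 * INR (S k))) =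
    4 * (- (2 * INR k) - 3) * contour_int (- (2 * INR (S k)) - 2)).
  { clear k; intros k; pose proof (contour_recursion (- (2 * INR (S k)))) as H.
    rewrite (INR_IZR_INZ (S k)) in H at 1.
    replace (- (2 * IZR (Z.of_nat (S k))) - 1) with (2 * IZR (- Z.of_nat (S k)) - 1) in H
      by (rewrite opp_IZR; ring).
    specialize (H (cos_odd_half_PI _)); rewrite S_INR in *.
    replace (- (2 * INR k)) with (- (2 * (INR k + 1)) + 2) by ring.
    rewrite H; ring. }
  induction k as [|k IH].
  - specialize (H 0%nat); simpl in *; lra.
  - specialize (H (S k)).
    replace (- (2 * INR (S (S k)))) with (- (2 * INR (S k)) - 2) in * by (rewrite !S_INR; ring).
    rewrite IH, Rmult_0_r in H; pose proof (pos_INR (S k)).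
    symmetry in H; apply Rmult_integral in H; destruct H; lra.
Qed.

(** * Contribution of the semicircle density *)

Lemma is_RInt_sin_sq : is_RInt (fun t => sin t * sin t) 0 (PI / 2) (PI / 4).
Proof.
  pose proof PI_RGT_0.
  set (F := fun t => t / 2 - sin t * cos t / 2).
  replace (PI / 4) with (F (PI / 2) - F 0).
  - apply is_RInt_primitive; [lra| |]; intros t _; [unfold F|]; auto_derive; trivial.
    real_eq; transitivity (1 / 2 - cos t ^ 2 / 2 + sin t ^ 2 / 2); [field|].
    transitivity (sin t ^ 2); [rewrite sin_sq; field | ring].
  - unfold F; rewrite sin_0, cos_PI2; real_eq; field.
Qed.

Lemma is_RInt_sin_sin k : is_RInt (fun t => sin ((2 * INR (S k) + 1) * t) * sin t) 0 (PI / 2) 0.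
Proof.
  pose proof PI_RGT_0; pose proof (pos_INR k).
  set (m := INR (S k)).
  assert (Hm : 0 < m) by (unfold m; rewrite S_INR; lra).
  set (F := fun t => sin (2 * m * t) / (4 * m) - sin (2 * (m + 1) * t) / (4 * (m + 1))).
  assert (E : F (PI / 2) - F 0 = 0).
  { unfold F; rewrite !Rmult_0_r, sin_0.
    replace (2 * m * (PI / 2)) with (m * PI) by field.
    replace (2 * (m + 1) * (PI / 2)) with ((m + 1) * PI) by field.
    rewrite !sin_eq_0_1.
    - real_eq; field; lra.
    - exists (Z.of_nat (S (S k))); rewrite <- INR_IZR_INZ, (S_INR (S k)); reflexivity.
    - exists (Z.of_nat (S k)); rewrite <- INR_IZR_INZ; reflexivity. }
  refine (eq_ind _ (is_RInt _ 0 (PI / 2)) _ _ E); apply is_RInt_primitive; [lra| |]; intros t _.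
  - unfold F; auto_derive; [repeat split; lra|].
    replace (2 * m * t) with ((2 * m + 1) * t - t) by ring.
    replace (2 * (m + 1) * t) with ((2 * m + 1) * t + t) by ring.
    rewrite cos_plus, cos_minus; real_eq; field; lra.
  - auto_derive; trivial.
Qed.

(** * The density in the coordinate [w] *)

(** The branches of [rho] as functions on the whole line; [sqrt] is 0 on negative arguments, so they
    are continuous everywhere, as the substitution lemma demands. *)
Definition rho_inner (x : R) : R :=
  / (4 * PI) * (sqrt (sqrt (100 - 16 * x ^ 2) - x ^ 2 + 10) - sqrt (4 - x ^ 2)).

Definition rho_outer (x : R) : R :=
  / (4 * PI) * sqrt (- 2 * x ^ 2 - 2 * x * sqrt (x ^ 2 - 4) + 20).

Lemma rho_inner_arc t : 0 <= t <= PI / 2 ->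
  rho_inner (2 * cos t) = (br_im t - sin t) / (2 * PI).
Proof.
  intros Ht; pose proof PI_RGT_0; unfold rho_inner.
  replace (100 - 16 * (2 * cos t) ^ 2) with ((2 * br_mod t) ^ 2)
    by (transitivity (4 * br_mod t ^ 2); [ring|]; rewrite br_mod_sq; ring).
  pose proof (br_mod_ge t); rewrite sqrt_pow2 by lra.
  replace (2 * br_mod t - (2 * cos t) ^ 2 + 10) with ((2 * br_im t) ^ 2)
    by (transitivity (4 * br_im t ^ 2); [ring|]; rewrite br_im_sq; field).
  pose proof (br_im_pos t); rewrite sqrt_pow2 by lra.
  replace (4 - (2 * cos t) ^ 2) with ((2 * sin t) ^ 2)
    by (transitivity (4 * sin t ^ 2); [ring|]; rewrite sin_sq; ring).
  assert (0 <= sin t) by (apply sin_ge_0; lra).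
  rewrite sqrt_pow2 by lra; field; lra.
Qed.

Lemma two_cos_ge_1 f : 0 <= f <= PI / 3 -> 1 <= 2 * cos f.
Proof.
  intros Hf; pose proof PI_RGT_0.
  assert (cos (PI / 3) <= cos f) by (apply cos_decr_1; lra).
  rewrite cos_PI3 in *; lra.
Qed.

(** As [w >= 1], [sqrt (x^2 - 4) = w - 1/w], and the outer radicand collapses to [16 - 4 w^2]. *)
Lemma rho_outer_seg f : 0 <= f <= PI / 3 ->
  rho_outer (2 * cos f + / (2 * cos f)) = sin f / PI.
Proof.
  intros Hf; pose proof PI_RGT_0; pose proof (two_cos_ge_1 f Hf) as Hw.
  unfold rho_outer; pose proof (sin_sq f) as Hs.
  assert (Hs0 : 0 <= sin f) by (apply sin_ge_0; lra).
  set (w := 2 * cos f) in *.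
  assert (Hiw : / w <= 1) by (rewrite <- Rinv_1; apply Rinv_le_contravar; lra).
  replace ((w + / w) ^ 2 - 4) with ((w - / w) ^ 2) by (field; lra).
  rewrite sqrt_pow2 by lra.
  replace (-2 * (w + / w) ^ 2 - 2 * (w + / w) * (w - / w) + 20) with ((4 * sin f) ^ 2).
  - rewrite sqrt_pow2 by lra; field; lra.
  - transitivity (16 - 4 * w ^ 2); [|field; lra].
    rewrite Rpow_mult_distr, Hs; unfold w; ring.
Qed.

Lemma rho_eq_inner x : Rabs x <= 2 -> rho x = rho_inner x.
Proof. intros H; unfold rho; destruct (Rle_dec (Rabs x) 2); [reflexivity|lra]. Qed.

Lemma rho_eq_outer x : 2 < x -> x <= 5 / 2 -> rho x = rho_outer x.
Proof.
  intros H1 H2; unfold rho; rewrite Rabs_pos_eq by lra.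
  destruct (Rle_dec x 2); [lra|]; destruct (Rle_dec x (5 / 2)); [reflexivity|lra].
Qed.

Lemma rho_opp x : rho (- x) = rho x.
Proof. unfold rho; rewrite Rabs_Ropp, <- !Rsqr_pow2, <- !Rsqr_neg; reflexivity. Qed.

Lemma rho_nonneg x : 0 <= rho x.
Proof.
  pose proof PI_RGT_0.
  assert (0 <= / (4 * PI)) by (apply Rlt_le, Rinv_0_lt_compat; lra).
  unfold rho; destruct (Rle_dec (Rabs x) 2) as [H2|_];
    [|destruct (Rle_dec (Rabs x) (5 / 2)); [|lra]];
    apply Rmult_le_pos; try assumption; [|apply sqrt_pos].
  apply Rle_minus_r; rewrite Rplus_0_l; apply sqrt_le_1_alt.
  pose proof (sqrt_pos (100 - 16 * x ^ 2)); lra.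
Qed.

Lemma continuous_chebU j x : continuous (chebU j) x.
Proof.
  apply (ex_derive_continuous (V := R_NormedModule)).
  revert j x; apply (chebU_ind (fun j x => ex_derive (chebU j) x)); intros.
  - apply (ex_derive_ext (fun _ => 1)); [reflexivity | auto_derive; trivial].
  - apply (ex_derive_ext (fun x => x)); [reflexivity | auto_derive; trivial].
  - apply (ex_derive_ext (fun x => x * chebU (S j) x - chebU j x)).
    + intros t; symmetry; apply chebU_rec.
    + auto_derive; auto.
Qed.

Lemma continuous_pow2 x : continuous (fun x => x ^ 2) x.
Proof. apply (ex_derive_continuous (V := R_NormedModule)); auto_derive; trivial. Qed.

Lemma continuous_rho_inner x : continuous rho_inner x.
Proof.
  unfold rho_inner.
  apply (continuous_mult (K := R_AbsRing)); [apply continuous_const|].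
  apply (continuous_minus (V := R_NormedModule)); apply continuous_sqrt_comp.
  - apply (continuous_plus (V := R_NormedModule)); [|apply continuous_const].
    apply (continuous_minus (V := R_NormedModule)); [|apply continuous_pow2].
    apply continuous_sqrt_comp, (ex_derive_continuous (V := R_NormedModule)).
    auto_derive; trivial.
  - apply (ex_derive_continuous (V := R_NormedModule)); auto_derive; trivial.
Qed.

Lemma continuous_rho_outer x : continuous rho_outer x.
Proof.
  unfold rho_outer.
  apply (continuous_mult (K := R_AbsRing)); [apply continuous_const|].
  apply continuous_sqrt_comp.
  apply (continuous_plus (V := R_NormedModule)); [|apply continuous_const].
  apply (continuous_minus (V := R_NormedModule));
    [|apply (continuous_mult (K := R_AbsRing))].
  - apply (ex_derive_continuous (V := R_NormedModule)); auto_derive; trivial.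
  - apply (ex_derive_continuous (V := R_NormedModule)); auto_derive; trivial.
  - apply continuous_sqrt_comp, (ex_derive_continuous (V := R_NormedModule)).
    auto_derive; trivial.
Qed.

Lemma is_RInt_decreasing_subst (f g dg : R -> R) a b c d v : a <= b -> g a = d -> g b = c ->
  (forall x, continuous f x) ->
  (forall x, a <= x <= b -> is_derive g x (dg x)) ->
  (forall x, a <= x <= b -> ex_derive dg x) ->
  is_RInt (fun t => - dg t * f (g t)) a b v ->
  is_RInt f c d v.
Proof.
  intros Hab <- <- Hf Hg Hdg Hv.
  assert (Hc : is_RInt (fun t => scal (dg t) (f (g t))) a b (RInt f (g a) (g b))).
  { apply (is_RInt_comp (V := R_CompleteNormedModule)); [auto|].
    rewrite Rmin_left, Rmax_right by exact Hab.
    intros x Hx; split; [auto|].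
    apply (ex_derive_continuous (V := R_NormedModule)); auto. }
  assert (E : v = - RInt f (g a) (g b)).
  { apply (is_RInt_value _ _ _ _ _ Hv).
    apply (is_RInt_ext (fun t => opp (scal (dg t) (f (g t))))).
    - intros t _; unfold opp, scal; simpl; unfold mult; simpl; ring.
    - exact (is_RInt_opp _ _ _ _ Hc). }
  rewrite E; apply (is_RInt_swap (V := R_NormedModule)).
  apply (RInt_correct (V := R_CompleteNormedModule)).
  apply (ex_RInt_continuous (V := R_CompleteNormedModule)); auto.
Qed.

(** In the difference of the two arc integrands the cosine terms cancel and the sine terms double.
    The value [s] accounts for the subtracted semicircle density. *)
Lemma chebU_rho_inner j s :
  is_RInt (fun t => sin ((INR j + 1) * t) * sin t) 0 (PI / 2) s ->
  is_RInt (fun x => chebU j x * rho x) 0 2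
    ((RInt (arc_integrand (INR j)) 0 (PI / 2) -
      RInt (arc_integrand (- INR j - 2)) 0 (PI / 2)) / (2 * PI) - s / PI).
Proof.
  intros Hs; pose proof PI_RGT_0.
  apply (is_RInt_ext (fun x => chebU j x * rho_inner x)).
  { rewrite Rmin_left, Rmax_right by lra; intros x Hx.
    rewrite rho_eq_inner; [reflexivity | rewrite Rabs_pos_eq; lra]. }
  set (g := fun t => 2 * cos t).
  apply (is_RInt_decreasing_subst _ g (fun t => - 2 * sin t) 0 (PI / 2)).
  - lra.
  - unfold g; rewrite cos_0; ring.
  - unfold g; rewrite cos_PI2; ring.
  - intros x; apply (continuous_mult (K := R_AbsRing));
      [apply continuous_chebU | apply continuous_rho_inner].
  - intros x _; unfold g; auto_derive; [trivial | real_eq; ring].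
  - intros x _; auto_derive; trivial.
  - set (u := RInt (arc_integrand (INR j)) 0 (PI / 2)).
    set (v := RInt (arc_integrand (- INR j - 2)) 0 (PI / 2)).
    replace ((u - v) / (2 * PI) - s / PI) with
      (/ (2 * PI) * (1 * u - 1 * v) - / PI * s) by (field; lra).
    refine (is_RInt_ext _ _ _ _ _ _ (is_RInt_lin2 _ _ _ _ _ _ _ _
      (is_RInt_lin2 _ _ _ _ 1 1 _ _ (is_RInt_arc (INR j)) (is_RInt_arc (- INR j - 2))) Hs)).
    rewrite Rmin_left, Rmax_right by lra; intros t Ht; real_eq.
    unfold g; rewrite rho_inner_arc by lra.
    transitivity (/ PI * (chebU j (2 * cos t) * sin t) * (br_im t - sin t)); [|field; lra].
    rewrite chebU_trig; unfold arc_integrand.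
    replace ((- INR j - 2 + 1) * t) with (- ((INR j + 1) * t)) by ring.
    rewrite sin_neg, cos_neg; field; lra.
Qed.

Lemma chebU_rho_outer j :
  is_RInt (fun x => chebU j x * rho x) 2 (5 / 2)
    ((RInt (seg_integrand (INR j)) 0 (PI / 3) -
      RInt (seg_integrand (- INR j - 2)) 0 (PI / 3)) / (2 * PI)).
Proof.
  pose proof PI_RGT_0.
  apply (is_RInt_ext (fun x => chebU j x * rho_outer x)).
  { rewrite Rmin_left, Rmax_right by lra; intros x Hx.
    rewrite rho_eq_outer by lra; reflexivity. }
  set (g := fun t => 2 * cos t + / (2 * cos t)).
  apply (is_RInt_decreasing_subst _ g
    (fun t => - 2 * sin t * (1 - / (2 * cos t) ^ 2)) 0 (PI / 3)).
  - lra.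
  - unfold g; rewrite cos_0; field.
  - unfold g; rewrite cos_PI3; field.
  - intros x; apply (continuous_mult (K := R_AbsRing));
      [apply continuous_chebU | apply continuous_rho_outer].
  - intros x Hx; pose proof (two_cos_ge_1 x Hx); unfold g; auto_derive; [lra|].
    real_eq; field; lra.
  - intros x Hx; pose proof (two_cos_ge_1 x Hx); auto_derive; apply Rgt_not_eq; nra.
  - set (u := RInt (seg_integrand (INR j)) 0 (PI / 3)).
    set (v := RInt (seg_integrand (- INR j - 2)) 0 (PI / 3)).
    replace ((u - v) / (2 * PI)) with (/ (2 * PI) * u - / (2 * PI) * v) by (field; lra).
    refine (is_RInt_ext _ _ _ _ _ _ (is_RInt_lin2 _ _ _ _ _ _ _ _
      (is_RInt_seg (INR j)) (is_RInt_seg (- INR j - 2)))).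
    rewrite Rmin_left, Rmax_right by lra; intros t Ht; real_eq.
    assert (Ht' : 0 <= t <= PI / 3) by lra.
    pose proof (two_cos_ge_1 t Ht').
    unfold g; rewrite rho_outer_seg by exact Ht'.
    unfold seg_integrand; set (w := 2 * cos t) in *.
    assert (Hp : forall n, exp (INR n * ln w) = w ^ n)
      by (intros n; apply (Rpower_pow n w); lra).
    replace (- INR j - 2) with (- INR (S (S j))) by (rewrite !S_INR; ring).
    rewrite <- Ropp_mult_distr_l, exp_Ropp, !Hp.
    transitivity (2 / PI * sin t ^ 2 * / w * (chebU j (w + / w) * (w - / w)));
      [|field; lra].
    rewrite chebU_joukowski by lra; rewrite pow_inv; simpl; field.
    repeat split; try lra; apply pow_nonzero; lra.
Qed.

(** For odd [j] existence suffices: the value is cancelled by symmetry. *)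
Lemma chebU_rho_half j : exists v, is_RInt (fun x => chebU j x * rho x) 0 (5 / 2) v.
Proof.
  assert (Hs : ex_RInt (fun t => sin ((INR j + 1) * t) * sin t) 0 (PI / 2)).
  { pose proof PI_RGT_0; apply ex_RInt_derivable; [lra|]; intros; auto_derive; trivial. }
  destruct Hs as [s Hs]; eexists.
  exact (is_RInt_Chasles _ _ _ _ _ _ (chebU_rho_inner j s Hs) (chebU_rho_outer j)).
Qed.

Lemma chebU_rho_half_even k :
  is_RInt (fun x => chebU (2 * k) x * rho x) 0 (5 / 2) (ballot (2 * k) 0 / 2).
Proof.
  pose proof PI_RGT_0.
  assert (Hs : exists s, is_RInt (fun t => sin ((INR (2 * k) + 1) * t) * sin t) 0 (PI / 2) s
    /\ (contour_int (INR (2 * k)) - contour_int (- INR (2 * k) - 2)) / (2 * PI) - s / PI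
       = ballot (2 * k) 0 / 2).
  { rewrite mult_INR; change (INR 2) with 2; rewrite contour_even.
    (* Index 0 is exceptional: the integral at exponent -2 is [- PI / 2] and the semicircle term is
       [PI / 4], giving [3/4 - 1/4 = 1/2]. For larger indices both corrections vanish. *)
    destruct k as [|k].
    - exists (PI / 4); split.
      + refine (is_RInt_ext _ _ _ _ _ _ is_RInt_sin_sq); intros t _.
        simpl; do 2 f_equal; ring.
      + replace (- (2 * INR 0) - 2) with (-2) by (simpl; ring).
        rewrite contour_minus_2; simpl; field; lra.
    - exists 0; split; [apply is_RInt_sin_sin|].
      rewrite contour_negative; field; lra. }
  destruct Hs as (s & Hs & <-).
  pose proof (is_RInt_Chasles _ _ _ _ _ _ (chebU_rho_inner _ s Hs) (chebU_rho_outer _)) as HI.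
  refine (eq_ind _ (is_RInt _ 0 (5 / 2)) HI _ _).
  unfold plus, contour_int; simpl; field; lra.
Qed.

(** * Moments over the full support *)

Lemma chebU_rho_symmetric j v :
  is_RInt (fun x => chebU j x * rho x) 0 (5 / 2) v ->
  is_RInt (fun x => chebU j x * rho x) (- (5 / 2)) (5 / 2) (((-1) ^ j + 1) * v).
Proof.
  intros Hv.
  assert (Hn : is_RInt (fun x => chebU j x * rho x) (- (5 / 2)) 0 ((-1) ^ j * v)).
  (* One [opp] comes from the reflection [x -> -x], the other is put into the integrand to cancel
     it. *)
  { apply (is_RInt_ext (fun x => scal ((-1) ^ j) (opp (opp (chebU j (- x) * rho (- x)))))).
    - intros x _; rewrite opp_opp, chebU_opp, rho_opp.
      unfold scal; simpl; unfold mult; simpl.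
      transitivity (((-1) * (-1)) ^ j * (chebU j x * rho x)); [rewrite Rpow_mult_distr; ring|].
      replace (-1 * -1) with 1 by ring; rewrite pow1; ring.
    - apply (is_RInt_scal (V := R_NormedModule)).
      apply (is_RInt_comp_opp (V := R_NormedModule) (fun y => opp (chebU j y * rho y))).
      rewrite Ropp_involutive, Ropp_0.
      rewrite <- (opp_opp v); apply (is_RInt_swap (V := R_NormedModule)).
      exact (is_RInt_opp _ _ _ _ Hv). }
  refine (eq_ind _ (is_RInt _ _ _) (is_RInt_Chasles _ _ _ _ _ _ Hn Hv) _ _).
  unfold plus; simpl; real_eq; ring.
Qed.

Lemma chebU_rho_moment j :
  is_RInt (fun x => chebU j x * rho x) (- (5 / 2)) (5 / 2) (ballot j 0).
Proof.
  destruct (Nat.Even_or_Odd j) as [[k ->] | [k ->]].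
  - refine (eq_ind _ (is_RInt _ _ _) (chebU_rho_symmetric _ _ (chebU_rho_half_even k)) _ _).
    rewrite pow_1_even; real_eq; field.
  - destruct (chebU_rho_half (2 * k + 1)) as [v Hv].
    refine (eq_ind _ (is_RInt _ _ _) (chebU_rho_symmetric _ _ Hv) _ _).
    rewrite ballot_return_odd, Nat.add_1_r, pow_1_odd; real_eq; ring.
Qed.

Lemma is_RInt_sum_f_R0 (f : nat -> R -> R) (v : nat -> R) a b n :
  (forall i, is_RInt (f i) a b (v i)) ->
  is_RInt (fun x => sum_f_R0 (fun i => f i x) n) a b (sum_f_R0 v n).
Proof.
  intros H; induction n as [|n IH]; [apply H|].
  exact (is_RInt_plus _ _ _ _ _ _ IH (H (S n))).
Qed.

Lemma rho_moment n :
  is_RInt (fun x => x ^ n * rho x) (- (5 / 2)) (5 / 2) (vacuum_moment n).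
Proof.
  rewrite vacuum_moment_ballot.
  apply (is_RInt_ext (fun x => sum_f_R0 (fun j => ballot n j * (chebU j x * rho x)) n)).
  - intros x _; rewrite (pow_chebU n x n) by lia.
    rewrite Rmult_comm, scal_sum; apply sum_eq; intros i _; ring.
  - apply is_RInt_sum_f_R0; intros j.
    exact (is_RInt_scal _ _ _ _ _ (chebU_rho_moment j)).
Qed.

(* The distribution of G_1 + G_2 in the vacuum state is rho(x) dx:
   rho is a nonnegative function (vanishing outside [-5/2,5/2] by definition)
   and every vacuum moment omega_Omega((G_1+G_2)^n) equals the n-th moment
   of rho(x) dx.  (Compact support => moments determine the measure.) *)
Theorem theorem3p4 :
  (forall x : R, 0 <= rho x) /\
  (forall n : nat,
     exists pr : Riemann_integrable (fun x => x ^ n * rho x) (- (5 / 2)) (5 / 2),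
       RiemannInt pr = vacuum_moment n).
Proof.
  split; [exact rho_nonneg|]; intros n.
  pose proof (rho_moment n) as H.
  exists (ex_RInt_Reals_0 _ _ _ (ex_intro _ _ H)).
  rewrite <- RInt_Reals.
  exact (is_RInt_unique (V := R_CompleteNormedModule) _ _ _ _ H).
Qed.
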